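(* Let $\mathsf C$ be a rig category and $\mathrm{s}(\mathsf C)$ its strictification. Then $\mathrm{s}(\mathsf C)$ is an $\mathrm{Ob}(\mathsf C)$-sesquistrict rig category; that is, for the functor $H$ from the discrete category $\mathrm{Ob}(\mathsf C)$ to $\mathrm{s}(\mathsf C)$ sending each object $A$ to the one-letter word of one-letter words $A$, the left distributor $\delta^l_{H(A),P,Q}$ of $\mathrm{s}(\mathsf C)$ is an identity morphism for every object $A$ of $\mathsf C$ and all objects $P,Q$ of $\mathrm{s}(\mathsf C)$.
   Context: A rig category is a category with two symmetric monoidal structures $(\otimes,1,\sigma^\otimes)$ and $(\oplus,0,\sigma^\oplus)$ and natural isomorphisms $\delta^l_{X,Y,Z}:X\otimes(Y\oplus Z)\to(X\otimes Y)\oplus(X\otimes Z)$, $\delta^r_{X,Y,Z}:(X\oplus Y)\otimes Z\to(X\otimes Z)\oplus(Y\otimes Z)$, $\lambda^\bullet_X:0\otimes X\to0$, $\rho^\bullet_X:X\otimes0\to0$ satisfying Laplaza's coherence axioms. It is (right) strict if both monoidal structures are strict and $\delta^r,\lambda^\bullet,\rho^\bullet$ are identities. A sesquistrict rig category is a functor $H:\mathsf S\to\mathsf D$ with $\mathsf S$ discrete and $\mathsf D$ a strict rig category such that $\delta^l_{H(A),X,Y}$ is an identity for all $A\in\mathsf S$ and all $X,Y$ (one says $\mathsf D$ is $\mathsf S$-sesquistrict). The strictification $\mathrm{s}(\mathsf C)$: objects are finite words of finite words of objects of $\mathsf C$ (formal non-commutative polynomials $P=\bigoplus_i U_i$, $U_i$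 words of objects); $\pi(P)$ denotes the object of $\mathsf C$ obtained by interpreting $P$ with right bracketing (empty words as $0$ or $1$); $\mathrm{s}(\mathsf C)[P,Q]=\mathsf C[\pi P,\pi Q]$ with composition of $\mathsf C$; $\oplus$ is concatenation of outer words, and $\otimes$ on objects is $(\bigoplus_iU_i)\otimes(\bigoplus_jV_j)=\bigoplus_i\bigoplus_jU_iV_j$; the action of $\oplus,\otimes$ on arrows, the symmetries, and the left distributor are those of $\mathsf C$ conjugated by the canonical structural isomorphisms of $\mathsf C$ (given by the coherence theorem for rig categories); e.g. $\delta^l_{S,P,Q}$ in $\mathrm{s}(\mathsf C)$ is $\sigma^\otimes_{S,P\oplus Q};(\sigma^\otimes_{P,S}\oplus\sigma^\otimes_{Q,S})$ with $\sigma^\otimes_{R,T}$ of $\mathrm{s}(\mathsf C)$ given by $\pi(R\otimes T)\cong\pi R\otimes\pi T\xrightarrow{\sigma^\otimes}\pi T\otimes\pi R\cong\pi(T\otimes R)$. This makes $\mathrm{s}(\mathsf C)$ a strict rig category equivalent to $\mathsf C$. *)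

(* Defs.v *)
From mathcomp Require Import all_boot.

Set Implicit Arguments.
Unset Strict Implicit.
Unset Printing Implicit Defensive.

Declare Scope cat_scope.
Delimit Scope cat_scope with cat.
Local Open Scope cat_scope.

Record category := Category {
  ob :> Type;
  hom : ob -> ob -> Type;
  idm : forall X, hom X X;
  comp : forall X Y Z, hom X Y -> hom Y Z -> hom X Z;
  comp1m : forall X Y (f : hom X Y), comp (idm X) f = f;
  compm1 : forall X Y (f : hom X Y), comp f (idm Y) = f;
  compA : forall X Y Z W (f : hom X Y) (g : hom Y Z) (h : hom Z W),
    comp f (comp g h) = comp (comp f g) h }.

Arguments idm {c} X.
Arguments comp {c X Y Z} f g.

(* Composition is written in diagrammatic order: first [f], then [g]. *)
Notation "f \; g" := (comp f g) : cat_scope.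

Record iso (C : category) (X Y : C) := Iso {
  fwd :> hom X Y;
  bwd : hom Y X;
  fwdK : fwd \; bwd = idm X;
  bwdK : bwd \; fwd = idm Y }.

Definition iso_id (C : category) (X : C) : iso X X :=
  Iso (comp1m (idm X)) (comp1m (idm X)).

Definition iso_inv (C : category) (X Y : C) (f : iso X Y) : iso Y X :=
  Iso (bwdK f) (fwdK f).

Lemma iso_comp_subproof (C : category) (X Y Z : C)
    (f : hom X Y) (f' : hom Y X) (g : hom Y Z) (g' : hom Z Y) :
  f \; f' = idm X -> g \; g' = idm Y -> (f \; g) \; (g' \; f') = idm X.
Proof. by move=> fK gK; rewrite compA -(compA f) gK compm1. Qed.

Definition iso_comp (C : category) (X Y Z : C) (f : iso X Y) (g : iso Y Z) :
    iso X Z :=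
  Iso (iso_comp_subproof (fwdK f) (fwdK g))
      (iso_comp_subproof (bwdK g) (bwdK f)).

Notation "f \;; g" := (iso_comp f g)
  (at level 60, right associativity) : cat_scope.

(* The identity of [X], seen as an arrow to an object equal to [X]. *)
Definition iso_eq (C : category) (X Y : C) (e : X = Y) : iso X Y :=
  match e with erefl => iso_id X end.

(* [f : hom X Y] is an identity: [X] and [Y] are the same object and [f] is
   the identity arrow on it. *)
Variant is_identity (C : category) : forall X Y : C, hom X Y -> Prop :=
  IsIdentity X : is_identity (idm X).

Record functor (C D : category) := Functor {
  fob :> C -> D;
  fmap : forall X Y, hom X Y -> hom (fob X) (fob Y);
  fmap_id : forall X, fmap (idm X) = idm (fob X);
  fmap_comp : forall X Y Z (f : hom X Y) (g : hom Y Z),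
    fmap (f \; g) = fmap f \; fmap g }.

Definition is_discrete (C : category) : Prop :=
  forall (X Y : C) (f : hom X Y), is_identity f.

Lemma discrete_1m (T : Type) (x y : T) (e : x = y) :
  etrans (erefl x) e = e.
Proof. by case: y / e. Qed.

Lemma discrete_m1 (T : Type) (x y : T) (e : x = y) :
  etrans e (erefl y) = e.
Proof. by case: y / e. Qed.

Lemma discrete_A (T : Type) (x y z t : T) (e : x = y) (e' : y = z)
    (e'' : z = t) :
  etrans e (etrans e' e'') = etrans (etrans e e') e''.
Proof. by case: t / e''; case: z / e'; case: y / e. Qed.

Definition discrete (T : Type) : category :=
  @Category T (fun x y => x = y) (@erefl T) (@etrans T)
    (@discrete_1m T) (@discrete_m1 T) (@discrete_A T).

Lemma discrete_map_comp (T : Type) (D : category) (F : T -> D) (x y z : T)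
    (e : x = y) (e' : y = z) :
  iso_eq (congr1 F (etrans e e')) =
  iso_eq (congr1 F e) \; iso_eq (congr1 F e') :> hom (F x) (F z).
Proof. by case: z / e'; case: y / e => /=; rewrite comp1m. Qed.

Definition discrete_functor (T : Type) (D : category) (F : T -> D) :
    functor (discrete T) D :=
  @Functor (discrete T) D F (fun x y (e : x = y) => iso_eq (congr1 F e))
    (fun x => erefl) (@discrete_map_comp T D F).

Record symmon_data (C : category) := SymmonData {
  tob : C -> C -> C;
  tmap : forall X Y X' Y',
    hom X X' -> hom Y Y' -> hom (tob X Y) (tob X' Y');
  tmap_id : forall X Y, tmap (idm X) (idm Y) = idm (tob X Y);
  tmap_comp : forall X Y X' Y' X'' Y'' (f : hom X X') (f' : hom X' X'')
      (g : hom Y Y') (g' : hom Y' Y''),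
    tmap (f \; f') (g \; g') = tmap f g \; tmap f' g';
  tunit : C;
  assoc : forall X Y Z, iso (tob (tob X Y) Z) (tob X (tob Y Z));
  lunit : forall X, iso (tob tunit X) X;
  runit : forall X, iso (tob X tunit) X;
  braid : forall X Y, iso (tob X Y) (tob Y X) }.

Arguments tob {C} M X Y : rename.
Arguments tmap {C} M {X Y X' Y'} f g : rename.
Arguments tunit {C} M : rename.
Arguments assoc {C} M X Y Z : rename.
Arguments lunit {C} M X : rename.
Arguments runit {C} M X : rename.
Arguments braid {C} M X Y : rename.

Lemma tmap_iso_subproof (C : category) (M : symmon_data C) (X Y X' Y' : C)
    (f : hom X X') (f' : hom X' X) (g : hom Y Y') (g' : hom Y' Y) :
  f \; f' = idm X -> g \; g' = idm Y ->
  tmap M f g \; tmap M f' g' = idm (tob M X Y).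
Proof. by move=> fK gK; rewrite -tmap_comp fK gK tmap_id. Qed.

Definition tmap_iso (C : category) (M : symmon_data C) (X Y X' Y' : C)
    (f : iso X X') (g : iso Y Y') : iso (tob M X Y) (tob M X' Y') :=
  Iso (tmap_iso_subproof M (fwdK f) (fwdK g))
      (tmap_iso_subproof M (bwdK f) (bwdK g)).

Section SymmonAxioms.
Variables (C : category) (M : symmon_data C).
Local Notation "X ⊠ Y" := (tob M X Y) (at level 40, left associativity).
Local Notation "f ⊠₁ g" := (tmap M f g) (at level 40, left associativity).
Local Notation α := (assoc M).
Local Notation λ := (lunit M).
Local Notation ρ := (runit M).
Local Notation σ := (braid M).

Record is_symmon : Prop := IsSymmon {
  assoc_natural : forall X Y Z X' Y' Z'
      (f : hom X X') (g : hom Y Y') (h : hom Z Z'),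
    ((f ⊠₁ g) ⊠₁ h) \; α X' Y' Z' = α X Y Z \; (f ⊠₁ (g ⊠₁ h));
  lunit_natural : forall X X' (f : hom X X'),
    (idm (tunit M) ⊠₁ f) \; λ X' = λ X \; f;
  runit_natural : forall X X' (f : hom X X'),
    (f ⊠₁ idm (tunit M)) \; ρ X' = ρ X \; f;
  braid_natural : forall X Y X' Y' (f : hom X X') (g : hom Y Y'),
    (f ⊠₁ g) \; σ X' Y' = σ X Y \; (g ⊠₁ f);
  pentagon : forall X Y Z W,
    α (X ⊠ Y) Z W \; α X Y (Z ⊠ W) =
    (α X Y Z ⊠₁ idm W) \; α X (Y ⊠ Z) W \; (idm X ⊠₁ α Y Z W);
  triangle : forall X Y,
    α X (tunit M) Y \; (idm X ⊠₁ λ Y) = ρ X ⊠₁ idm Y;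
  hexagon : forall X Y Z,
    α X Y Z \; σ X (Y ⊠ Z) \; α Y Z X =
    (σ X Y ⊠₁ idm Z) \; α Y X Z \; (idm Y ⊠₁ σ X Z);
  braidK : forall X Y, σ X Y \; σ Y X = idm (X ⊠ Y) }.

Record is_strict_mon : Prop := IsStrictMon {
  assoc_strict : forall X Y Z, is_identity (α X Y Z);
  lunit_strict : forall X, is_identity (λ X);
  runit_strict : forall X, is_identity (ρ X) }.

(* The canonical map (W X)(Y Z) -> (W Y)(X Z). *)
Definition interchange (W X Y Z : C) :
    hom ((W ⊠ X) ⊠ (Y ⊠ Z)) ((W ⊠ Y) ⊠ (X ⊠ Z)) :=
  α W X (Y ⊠ Z)
  \; (idm W ⊠₁ (iso_inv (α X Y Z) \; (σ X Y ⊠₁ idm Z) \; α Y X Z))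
  \; iso_inv (α W Y (X ⊠ Z)).

End SymmonAxioms.

(* The arguments of [lann] and [rann] are the non-zero factor:
   [lann X] is the annihilator 0 X -> 0 and [rann X] is X 0 -> 0. *)
Record rig_data := RigData {
  rig_cat :> category;
  rig_add : symmon_data rig_cat;
  rig_mul : symmon_data rig_cat;
  distl : forall X Y Z, iso (tob rig_mul X (tob rig_add Y Z))
                            (tob rig_add (tob rig_mul X Y) (tob rig_mul X Z));
  distr : forall X Y Z, iso (tob rig_mul (tob rig_add X Y) Z)
                            (tob rig_add (tob rig_mul X Z) (tob rig_mul Y Z));
  lann : forall X, iso (tob rig_mul (tunit rig_add) X) (tunit rig_add);
  rann : forall X, iso (tob rig_mul X (tunit rig_add)) (tunit rig_add) }.

Arguments rig_add : clear implicits.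
Arguments rig_mul : clear implicits.
Arguments distl {r} X Y Z.
Arguments distr {r} X Y Z.
Arguments lann {r} X.
Arguments rann {r} X.

Notation "X ⊕ Y" := (tob (rig_add _) X Y)
  (at level 50, left associativity) : cat_scope.
Notation "X ⊗ Y" := (tob (rig_mul _) X Y)
  (at level 40, left associativity) : cat_scope.
Notation "f ⊕₁ g" := (tmap (rig_add _) f g)
  (at level 50, left associativity) : cat_scope.
Notation "f ⊗₁ g" := (tmap (rig_mul _) f g)
  (at level 40, left associativity) : cat_scope.

Section RigAxioms.
Variable D : rig_data.
Local Notation "𝟘" := (tunit (rig_add D)).
Local Notation "𝟙" := (tunit (rig_mul D)).
Local Notation "α⊕" := (assoc (rig_add D)).
Local Notation "λ⊕" := (lunit (rig_add D)).
Local Notation "ρ⊕" := (runit (rig_add D)).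
Local Notation "σ⊕" := (braid (rig_add D)).
Local Notation "α⊗" := (assoc (rig_mul D)).
Local Notation "λ⊗" := (lunit (rig_mul D)).
Local Notation "ρ⊗" := (runit (rig_mul D)).
Local Notation "σ⊗" := (braid (rig_mul D)).
Local Notation "'δl'" := (@distl D).
Local Notation "'δr'" := (@distr D).
Local Notation "λ•" := (@lann D).
Local Notation "ρ•" := (@rann D).

(* [laplaza1] to [laplaza24] are the 24 coherence conditions of M. Laplaza,
   Coherence for distributivity (1972). *)
Record is_rig : Prop := IsRig {
  sum_symmon : is_symmon (rig_add D);
  prod_symmon : is_symmon (rig_mul D);
  distl_natural : forall (X Y Z X' Y' Z' : D)
      (f : hom X X') (g : hom Y Y') (h : hom Z Z'),
    (f ⊗₁ (g ⊕₁ h)) \; δl X' Y' Z' = δl X Y Z \; ((f ⊗₁ g) ⊕₁ (f ⊗₁ h));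
  distr_natural : forall (X Y Z X' Y' Z' : D)
      (f : hom X X') (g : hom Y Y') (h : hom Z Z'),
    ((f ⊕₁ g) ⊗₁ h) \; δr X' Y' Z' = δr X Y Z \; ((f ⊗₁ h) ⊕₁ (g ⊗₁ h));
  lann_natural : forall (X X' : D) (f : hom X X'),
    (idm 𝟘 ⊗₁ f) \; λ• X' = λ• X;
  rann_natural : forall (X X' : D) (f : hom X X'),
    (f ⊗₁ idm 𝟘) \; ρ• X' = ρ• X;
  laplaza1 : forall X Y Z : D,
    δl X Y Z \; σ⊕ (X ⊗ Y) (X ⊗ Z) = (idm X ⊗₁ σ⊕ Y Z) \; δl X Z Y;
  laplaza2 : forall X Y Z : D,
    δr X Y Z \; (σ⊗ X Z ⊕₁ σ⊗ Y Z) = σ⊗ (X ⊕ Y) Z \; δl Z X Y;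
  laplaza3 : forall X Y Z : D,
    δr X Y Z \; σ⊕ (X ⊗ Z) (Y ⊗ Z) = (σ⊕ X Y ⊗₁ idm Z) \; δr Y X Z;
  laplaza4 : forall X Y Z W : D,
    δr (X ⊕ Y) Z W \; (δr X Y W ⊕₁ idm (Z ⊗ W))
      \; α⊕ (X ⊗ W) (Y ⊗ W) (Z ⊗ W) =
    (α⊕ X Y Z ⊗₁ idm W) \; δr X (Y ⊕ Z) W \; (idm (X ⊗ W) ⊕₁ δr Y Z W);
  laplaza5 : forall X Y Z W : D,
    δl X (Y ⊕ Z) W \; (δl X Y Z ⊕₁ idm (X ⊗ W))
      \; α⊕ (X ⊗ Y) (X ⊗ Z) (X ⊗ W) =
    (idm X ⊗₁ α⊕ Y Z W) \; δl X Y (Z ⊕ W) \; (idm (X ⊗ Y) ⊕₁ δl X Z W);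
  laplaza6 : forall X Y Z W : D,
    δl (X ⊗ Y) Z W \; (α⊗ X Y Z ⊕₁ α⊗ X Y W) =
    α⊗ X Y (Z ⊕ W) \; (idm X ⊗₁ δl Y Z W) \; δl X (Y ⊗ Z) (Y ⊗ W);
  laplaza7 : forall X Y Z W : D,
    (δr X Y Z ⊗₁ idm W) \; δr (X ⊗ Z) (Y ⊗ Z) W
      \; (α⊗ X Z W ⊕₁ α⊗ Y Z W) =
    α⊗ (X ⊕ Y) Z W \; δr X Y (Z ⊗ W);
  laplaza8 : forall X Y Z W : D,
    (δl X Y Z ⊗₁ idm W) \; δr (X ⊗ Y) (X ⊗ Z) W
      \; (α⊗ X Y W ⊕₁ α⊗ X Z W) =
    α⊗ X (Y ⊕ Z) W \; (idm X ⊗₁ δr Y Z W) \; δl X (Y ⊗ W) (Z ⊗ W);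
  laplaza9 : forall X Y Z W : D,
    δl (X ⊕ Y) Z W \; (δr X Y Z ⊕₁ δr X Y W) =
    δr X Y (Z ⊕ W) \; (δl X Z W ⊕₁ δl Y Z W)
      \; interchange (rig_add D) (X ⊗ Z) (X ⊗ W) (Y ⊗ Z) (Y ⊗ W);
  laplaza10 : λ• 𝟘 = ρ• 𝟘 :> hom _ _;
  laplaza11 : forall X Y : D,
    δl 𝟘 X Y \; (λ• X ⊕₁ λ• Y) \; λ⊕ 𝟘 = λ• (X ⊕ Y);
  laplaza12 : forall X Y : D,
    δr X Y 𝟘 \; (ρ• X ⊕₁ ρ• Y) \; λ⊕ 𝟘 = ρ• (X ⊕ Y);
  laplaza13 : λ• 𝟙 = ρ⊗ 𝟘 :> hom _ _;
  laplaza14 : ρ• 𝟙 = λ⊗ 𝟘 :> hom _ _;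
  laplaza15 : forall X : D, σ⊗ X 𝟘 \; λ• X = ρ• X;
  laplaza16 : forall X Y : D,
    α⊗ 𝟘 X Y \; λ• (X ⊗ Y) = (λ• X ⊗₁ idm Y) \; λ• Y;
  laplaza17 : forall X Y : D,
    α⊗ X 𝟘 Y \; (idm X ⊗₁ λ• Y) \; ρ• X = (ρ• X ⊗₁ idm Y) \; λ• Y;
  laplaza18 : forall X Y : D,
    α⊗ X Y 𝟘 \; (idm X ⊗₁ ρ• Y) \; ρ• X = ρ• (X ⊗ Y);
  laplaza19 : forall X Y : D,
    δl X 𝟘 Y \; (ρ• X ⊕₁ idm (X ⊗ Y)) \; λ⊕ (X ⊗ Y) = idm X ⊗₁ λ⊕ Y;
  laplaza20 : forall X Y : D,
    δr 𝟘 X Y \; (λ• Y ⊕₁ idm (X ⊗ Y)) \; λ⊕ (X ⊗ Y) = λ⊕ X ⊗₁ idm Y;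
  laplaza21 : forall X Y : D,
    δl X Y 𝟘 \; (idm (X ⊗ Y) ⊕₁ ρ• X) \; ρ⊕ (X ⊗ Y) = idm X ⊗₁ ρ⊕ Y;
  laplaza22 : forall X Y : D,
    δr X 𝟘 Y \; (idm (X ⊗ Y) ⊕₁ λ• Y) \; ρ⊕ (X ⊗ Y) = ρ⊕ X ⊗₁ idm Y;
  laplaza23 : forall X Y : D,
    δl 𝟙 X Y \; (λ⊗ X ⊕₁ λ⊗ Y) = λ⊗ (X ⊕ Y);
  laplaza24 : forall X Y : D,
    δr X Y 𝟙 \; (ρ⊗ X ⊕₁ ρ⊗ Y) = ρ⊗ (X ⊕ Y) }.

Record is_strict_rig : Prop := IsStrictRig {
  strict_is_rig : is_rig;
  sum_strict : is_strict_mon (rig_add D);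
  prod_strict : is_strict_mon (rig_mul D);
  distr_strict : forall X Y Z : D, is_identity (δr X Y Z);
  lann_strict : forall X : D, is_identity (λ• X);
  rann_strict : forall X : D, is_identity (ρ• X) }.

End RigAxioms.

Record rig_category := RigCategory {
  rig_struct :> rig_data;
  rig_axioms : is_rig rig_struct }.

Record is_sesquistrict (S : category) (D : rig_data) (H : functor S D) :
    Prop := IsSesquistrict {
  sesqui_discrete : is_discrete S;
  sesqui_strict : is_strict_rig D;
  sesqui_distl : forall (A : S) (X Y : D), is_identity (distl (H A) X Y) }.

Arguments is_sesquistrict : clear implicits.

Section Words.
Variables (C : category) (M : symmon_data C) (T : Type) (f : T -> C).

Fixpoint word (s : seq T) : C :=
  match s with
  | [::] => tunit M
  | [:: x] => f x
  | x :: s' => tob M (f x) (word s')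
  end.

Definition word_cons (x : T) (s : seq T) :
    iso (word (x :: s)) (tob M (f x) (word s)) :=
  match s return iso (word (x :: s)) (tob M (f x) (word s)) with
  | [::] => iso_inv (runit M (f x))
  | y :: s' => iso_id (word [:: x, y & s'])
  end.

Fixpoint word_cat (s t : seq T) :
    iso (word (s ++ t)) (tob M (word s) (word t)) :=
  match s return iso (word (s ++ t)) (tob M (word s) (word t)) with
  | [::] => iso_inv (lunit M (word t))
  | x :: s' =>
      word_cons x (s' ++ t)
      \;; tmap_iso M (iso_id (f x)) (word_cat s' t)
      \;; iso_inv (assoc M (f x) (word s') (word t))
      \;; tmap_iso M (iso_inv (word_cons x s')) (iso_id (word t))
  end.

End Words.

Section Strictification.
Variable C : rig_category.

Definition monomial := seq C.
Definition polynomial := seq monomial.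

Definition interp_mono : monomial -> C := word (rig_mul C) id.
Definition interp : polynomial -> C := word (rig_add C) interp_mono.

Definition poly_prod (P Q : polynomial) : polynomial :=
  [seq U ++ V | U <- P, V <- Q].

Lemma poly_prodDl P Q R :
  poly_prod (P ++ Q) R = poly_prod P R ++ poly_prod Q R.
Proof. exact: allpairs_cat. Qed.

Lemma poly_prod0 P : poly_prod P [::] = [::].
Proof. by elim: P. Qed.

Lemma poly_1prod P : poly_prod [:: [::]] P = P.
Proof. by rewrite /poly_prod /= cats0 map_id. Qed.

Lemma poly_prod1 P : poly_prod P [:: [::]] = P.
Proof. by rewrite /poly_prod allpairs1r (eq_map (@cats0 _)) map_id. Qed.

Lemma poly_prodA P Q R :
  poly_prod (poly_prod P Q) R = poly_prod P (poly_prod Q R).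
Proof.
elim: P => //= U P IHP.
rewrite [LHS]poly_prodDl -[LHS]/(_ ++ poly_prod (poly_prod P Q) R) IHP.
congr (_ ++ _); elim: Q {IHP} => //= V Q IHQ.
rewrite [LHS]/poly_prod /= -/(poly_prod _ R) IHQ map_cat -map_comp.
by congr (_ ++ _); apply: eq_map => W; rewrite /= catA.
Qed.

(* By Laplaza's coherence theorem the structural isomorphisms
   pi (P (+) Q) -> pi P (+) pi Q and pi (P (x) Q) -> pi P (x) pi Q are
   unique; the following recursions pick one composite representing each. *)

Definition interp_cat (P Q : polynomial) :
    iso (interp (P ++ Q)) (interp P ⊕ interp Q) :=
  word_cat (rig_add C) interp_mono P Q.

Fixpoint interp_scale (U : monomial) (Q : polynomial) :
    iso (interp [seq U ++ V | V <- Q]) (interp_mono U ⊗ interp Q) :=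
  match Q return
    iso (interp [seq U ++ V | V <- Q]) (interp_mono U ⊗ interp Q) with
  | [::] => iso_inv (rann (interp_mono U))
  | V :: Q' =>
      word_cons (rig_add C) interp_mono (U ++ V) [seq U ++ V | V <- Q']
      \;; tmap_iso (rig_add C) (word_cat (rig_mul C) id U V) (interp_scale U Q')
      \;; iso_inv (distl (interp_mono U) (interp_mono V) (interp Q'))
      \;; tmap_iso (rig_mul C) (iso_id (interp_mono U))
            (iso_inv (word_cons (rig_add C) interp_mono V Q'))
  end.

Fixpoint interp_prod (P Q : polynomial) :
    iso (interp (poly_prod P Q)) (interp P ⊗ interp Q) :=
  match P return iso (interp (poly_prod P Q)) (interp P ⊗ interp Q) with
  | [::] => iso_inv (lann (interp Q))
  | U :: P' =>
      interp_cat [seq U ++ V | V <- Q] (poly_prod P' Q)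
      \;; tmap_iso (rig_add C) (interp_scale U Q) (interp_prod P' Q)
      \;; iso_inv (distr (interp_mono U) (interp P') (interp Q))
      \;; tmap_iso (rig_mul C) (iso_inv (word_cons (rig_add C) interp_mono U P'))
            (iso_id (interp Q))
  end.

Definition strict_cat : category :=
  @Category polynomial (fun P Q => hom (interp P) (interp Q))
    (fun P => idm (interp P)) (fun P Q R f g => f \; g)
    (fun P Q f => comp1m f) (fun P Q f => compm1 f)
    (fun P Q R S f g h => compA f g h).

Definition strict_iso (P Q : polynomial) (i : iso (interp P) (interp Q)) :
    @iso strict_cat P Q :=
  @Iso strict_cat P Q (fwd i) (bwd i) (fwdK i) (bwdK i).

(* In [strict_cat] the two tensors act on arrows, and are symmetric, as in [C] up to
   conjugation by a family of isomorphisms [c]. *)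
Section Conjugation.
Variables (M : symmon_data C) (t : polynomial -> polynomial -> polynomial).
Variable c : forall P Q, iso (interp (t P Q)) (tob M (interp P) (interp Q)).

Definition conj_tmap (P Q P' Q' : polynomial)
    (f : hom (interp P) (interp P')) (g : hom (interp Q) (interp Q')) :
    hom (interp (t P Q)) (interp (t P' Q')) :=
  c P Q \; tmap M f g \; iso_inv (c P' Q').

Lemma conj_tmap_id P Q :
  conj_tmap (idm (interp P)) (idm (interp Q)) = idm (interp (t P Q)).
Proof. by rewrite /conj_tmap tmap_id comp1m fwdK. Qed.

Lemma conj_tmap_comp P Q P' Q' P'' Q''
    (f : hom (interp P) (interp P')) (f' : hom (interp P') (interp P''))
    (g : hom (interp Q) (interp Q')) (g' : hom (interp Q') (interp Q'')) :
  conj_tmap (f \; f') (g \; g') = conj_tmap f g \; conj_tmap f' g'.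
Proof.
rewrite /conj_tmap tmap_comp -!compA [iso_inv _ \; _]compA bwdK comp1m.
by rewrite !compA.
Qed.

Definition conj_braid (P Q : polynomial) :
    iso (interp (t P Q)) (interp (t Q P)) :=
  c P Q \;; braid M (interp P) (interp Q) \;; iso_inv (c Q P).

End Conjugation.

Definition strict_sum : symmon_data strict_cat :=
  @SymmonData strict_cat (fun P Q => P ++ Q)
    (@conj_tmap (rig_add C) _ interp_cat)
    (@conj_tmap_id (rig_add C) _ interp_cat)
    (@conj_tmap_comp (rig_add C) _ interp_cat)
    [::]
    (fun P Q R => iso_eq (C := strict_cat) (esym (catA P Q R)))
    (fun P => iso_eq (C := strict_cat) (cat0s P))
    (fun P => iso_eq (C := strict_cat) (cats0 P))
    (fun P Q => strict_iso (conj_braid interp_cat P Q)).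

Definition strict_prod : symmon_data strict_cat :=
  @SymmonData strict_cat poly_prod
    (@conj_tmap (rig_mul C) _ interp_prod)
    (@conj_tmap_id (rig_mul C) _ interp_prod)
    (@conj_tmap_comp (rig_mul C) _ interp_prod)
    [:: [::]]
    (fun P Q R => iso_eq (C := strict_cat) (poly_prodA P Q R))
    (fun P => iso_eq (C := strict_cat) (poly_1prod P))
    (fun P => iso_eq (C := strict_cat) (poly_prod1 P))
    (fun P Q => strict_iso (conj_braid interp_prod P Q)).

Definition strict_distr (P Q R : strict_cat) :
    iso (tob strict_prod (tob strict_sum P Q) R)
        (tob strict_sum (tob strict_prod P R) (tob strict_prod Q R)) :=
  iso_eq (C := strict_cat) (poly_prodDl P Q R).

(* [strict_distr] is an identity, so this is the composite
   braid S (P + Q) ; (braid P S + braid Q S) *)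
Definition strict_distl (S P Q : strict_cat) :
    iso (tob strict_prod S (tob strict_sum P Q))
        (tob strict_sum (tob strict_prod S P) (tob strict_prod S Q)) :=
  braid strict_prod S (tob strict_sum P Q)
  \;; strict_distr P Q S
  \;; tmap_iso strict_sum (braid strict_prod P S) (braid strict_prod Q S).

Definition strictification : rig_data :=
  @RigData strict_cat strict_sum strict_prod strict_distl strict_distr
    (fun P => iso_eq (C := strict_cat) (erefl [::]))
    (fun P => iso_eq (C := strict_cat) (poly_prod0 P)).

Definition letter : functor (discrete C) strictification :=
  @discrete_functor C strictification (fun A => [:: [:: A]]).

End Strictification.

(* Main.v *)
(* Concatenation and product of polynomials are sent by the interpretation pi to
   the tensors of C up to the isomorphisms [interp_cat] and [interp_prod].
   Inductions on words and polynomials show that these two families are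
   compatible with the associators, unitors, annihilators and the right
   distributor, the structure maps of s(C) being transported identities. So pi
   is a strong rig functor, and since it is fully faithful each axiom of C
   transfers to s(C). When the left factor is a single monomial, [interp_prod]
   is the recursion [interp_scale] on the right factor, which is built from the
   left distributor of C; hence it also turns the left distributor of s(C) at a
   monomial into an identity. *)
From Stdlib Require Import ProofIrrelevance.
From mathcomp Require Import all_boot.
Require Import Defs.

Set Implicit Arguments.
Unset Strict Implicit.
Unset Printing Implicit Defensive.
Local Open Scope cat_scope.

(** * Invertible arrows and rewriting inside composites *)

Section Isomorphisms.
Variable C : category.

(** A property of the bare arrow rather than the record [iso]: it is closed under composition and
    tensor by hints, so the side conditions of the cancellation lemmas below are found by [auto]. *)
Definition invertible (X Y : C) (f : hom X Y) :=
  exists g : hom Y X, f \; g = idm X /\ g \; f = idm Y.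

Lemma iso_invertible (X Y : C) (f : iso X Y) : invertible f.
Proof. by exists (bwd f); rewrite fwdK bwdK. Qed.

Lemma idm_invertible (X : C) : invertible (idm X).
Proof. by exists (idm X); rewrite comp1m. Qed.

Lemma comp_invertible (X Y Z : C) (f : hom X Y) (g : hom Y Z) :
  invertible f -> invertible g -> invertible (f \; g).
Proof.
move=> [f' [fK fK']] [g' [gK gK']]; exists (g' \; f').
by rewrite !iso_comp_subproof.
Qed.

Lemma tmap_invertible (M : symmon_data C) (X Y X' Y' : C)
    (f : hom X X') (g : hom Y Y') :
  invertible f -> invertible g -> invertible (tmap M f g).
Proof.
move=> [f' [fK fK']] [g' [gK gK']]; exists (tmap M f' g').
by rewrite !tmap_iso_subproof.
Qed.

Lemma invertible_monic (X Y Z : C) (i : hom Y Z) (f g : hom X Y) :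
  invertible i -> f \; i = g \; i -> f = g.
Proof.
move=> [j [iK _]] eq_fg.
by rewrite -[f]compm1 -[g]compm1 -iK !compA eq_fg.
Qed.

Lemma invertible_epic (X Y Z : C) (i : hom X Y) (f g : hom Y Z) :
  invertible i -> i \; f = i \; g -> f = g.
Proof.
move=> [j [_ iK]] eq_fg.
by rewrite -[f]comp1m -[g]comp1m -iK -!compA eq_fg.
Qed.

(** Composites are nested to the right, so an equation between arrows cannot be rewritten directly
    at the front of a longer composite; this form and the next extend it by a tail [h]. *)
Lemma reassoc (X Y Z W : C) (f : hom X Y) (g : hom Y Z) (k : hom X Z)
    (h : hom Z W) : f \; g = k -> f \; g \; h = k \; h.
Proof. by move=> <-; rewrite compA. Qed.

Lemma reassoc3 (X Y Z V W : C) (f : hom X Y) (g : hom Y Z) (g' : hom Z V)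
    (k : hom X V) (h : hom V W) :
  f \; g \; g' = k -> f \; g \; g' \; h = k \; h.
Proof. by move=> <-; rewrite !compA. Qed.

End Isomorphisms.

#[local] Hint Resolve iso_invertible idm_invertible comp_invertible
  tmap_invertible : core.

(** * Transport along equalities of objects *)

Section Cast.
Variables (C : category) (T : Type).

(** The equality lives on the index (a word or polynomial), not on the object of [C], so that
    transports can be combined and compared through equations of words. *)
Definition cast (F : T -> C) (x y : T) (e : x = y) : hom (F x) (F y) :=
  iso_eq (congr1 F e).

(* Equality on the objects of [C] need not be decidable, so uniqueness of
   identity proofs comes from proof irrelevance. *)
Lemma cast_id F x (e : x = x) : cast F e = idm (F x).
Proof. by rewrite (proof_irrelevance _ e erefl). Qed.

Lemma cast_irr F x y (e e' : x = y) : cast F e = cast F e'.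
Proof. by rewrite (proof_irrelevance _ e e'). Qed.

Lemma cast_comp F x y z (e : x = y) (e' : y = z) :
  cast F e \; cast F e' = cast F (etrans e e').
Proof. by case: z / e'; rewrite compm1. Qed.

Lemma cast_invertible F x y (e : x = y) : invertible (cast F e).
Proof. exact: iso_invertible. Qed.

End Cast.

#[local] Hint Resolve cast_invertible : core.

(** * Coherence of concatenation *)

Section Monoidal.
Variables (C : category) (M : symmon_data C).
Hypothesis monM : is_symmon M.
Local Notation "X ⊠ Y" := (tob M X Y) (at level 40, left associativity).
Local Notation "f ⊠₁ g" := (tmap M f g) (at level 40, left associativity).
Local Notation α := (assoc M).
Local Notation λ := (lunit M).
Local Notation ρ := (runit M).
Local Notation I := (tunit M).

Lemma tmap_compE X Y X' Y' X'' Y'' (f : hom X X') (f' : hom X' X'')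
    (g : hom Y Y') (g' : hom Y' Y'') :
  f ⊠₁ g \; f' ⊠₁ g' = (f \; f') ⊠₁ (g \; g').
Proof. by rewrite tmap_comp. Qed.

Lemma tmap_compEA X Y X' Y' X'' Y'' Z (f : hom X X') (f' : hom X' X'')
    (g : hom Y Y') (g' : hom Y' Y'') (h : hom (X'' ⊠ Y'') Z) :
  f ⊠₁ g \; f' ⊠₁ g' \; h = (f \; f') ⊠₁ (g \; g') \; h.
Proof. by rewrite compA tmap_compE. Qed.

Lemma tmap_compl X Y Z W (f : hom X Y) (g : hom Y Z) :
  (f \; g) ⊠₁ idm W = f ⊠₁ idm W \; g ⊠₁ idm W.
Proof. by rewrite tmap_compE comp1m. Qed.

Lemma tmap_compr X Y Z W (f : hom X Y) (g : hom Y Z) :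
  idm W ⊠₁ (f \; g) = idm W ⊠₁ f \; idm W ⊠₁ g.
Proof. by rewrite tmap_compE comp1m. Qed.

Lemma tmap_lr X Y X' Y' (f : hom X X') (g : hom Y Y') :
  f ⊠₁ g = f ⊠₁ idm Y \; idm X' ⊠₁ g.
Proof. by rewrite tmap_compE comp1m compm1. Qed.

Lemma tmap_rl X Y X' Y' (f : hom X X') (g : hom Y Y') :
  f ⊠₁ g = idm X ⊠₁ g \; f ⊠₁ idm Y'.
Proof. by rewrite tmap_compE comp1m compm1. Qed.

Lemma tmap_left X Y Z X' Y' (f : hom X Y) (g : hom Y Z) (h : hom X' Y') :
  (f \; g) ⊠₁ h = f ⊠₁ idm X' \; g ⊠₁ h.
Proof. by rewrite tmap_compE comp1m. Qed.

Lemma tmap_right X Y Z X' Y' (f : hom X Y) (g : hom Y Z) (h : hom X' Y') :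
  h ⊠₁ (f \; g) = idm X' ⊠₁ f \; h ⊠₁ g.
Proof. by rewrite tmap_compE comp1m. Qed.

Definition tmapE := (tmap_compE, tmap_compEA, comp1m, compm1).

(** Tensoring with the unit is faithful, since the unitor is a natural isomorphism from it to the
    identity functor. *)
Lemma tmap_unit_injr X Y (f g : hom X Y) : idm I ⊠₁ f = idm I ⊠₁ g -> f = g.
Proof.
move=> eq_fg; apply: (@invertible_epic _ _ _ _ (λ X)) => //.
by rewrite -!lunit_natural // eq_fg.
Qed.

Lemma tmap_unit_injl X Y (f g : hom X Y) : f ⊠₁ idm I = g ⊠₁ idm I -> f = g.
Proof.
move=> eq_fg; apply: (@invertible_epic _ _ _ _ (ρ X)) => //.
by rewrite -!runit_natural // eq_fg.
Qed.

(** Kelly's argument: after tensoring with the unit on the left, the equation follows from the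
    pentagon at [I], [I], [X], [Y] and the triangle. *)
Lemma assoc_lunit X Y : α I X Y \; λ (X ⊠ Y) = λ X ⊠₁ idm Y.
Proof.
apply: tmap_unit_injr.
apply: (@invertible_epic _ _ _ _ (α I I X ⊠₁ idm Y \; α I (I ⊠ X) Y)); auto.
rewrite -!compA tmap_compr.
rewrite (reassoc3 _ (esym (pentagon monM I I X Y))) -!compA triangle //.
rewrite -assoc_natural // !tmapE triangle //.
by rewrite -tmap_id assoc_natural.
Qed.

Lemma assoc_runit X Y : α X Y I \; (idm X ⊠₁ ρ Y) = ρ (X ⊠ Y).
Proof.
apply: tmap_unit_injl.
apply: (@invertible_monic _ _ _ _ (α X Y I)); auto.
rewrite tmap_compl -!compA assoc_natural //.
rewrite -(triangle monM Y I) tmap_compr.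
rewrite (reassoc3 _ (esym (pentagon monM X Y I I))) -!compA.
by rewrite -assoc_natural // tmap_id compA triangle.
Qed.

Lemma lunit_runit_unit : λ I = ρ I :> hom _ _.
Proof.
apply: tmap_unit_injl; rewrite -triangle // -assoc_lunit; congr (_ \; _).
(* Naturality of [λ] at the arrow [λ I] itself, with [λ I] cancelled, identifies [λ (I ⊠ I)] with
   [idm I ⊠₁ λ I]. *)
by apply: (@invertible_monic _ _ _ _ (λ I)) => //; rewrite -lunit_natural.
Qed.

Section WordCoherence.
Variables (T : Type) (f : T -> C).
Local Notation w := (word M f).
Variable κ : forall x s, iso (w (x :: s)) (f x ⊠ w s).
Variable φ : forall s t, iso (w (s ++ t)) (w s ⊠ w t).
Hypothesis cat_nil : forall t, φ [::] t \; λ (w t) = idm (w t).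
Hypothesis cat_cons : forall x s t,
  φ (x :: s) t \; (κ x s ⊠₁ idm (w t)) \; α (f x) (w s) (w t) =
  κ x (s ++ t) \; (idm (f x) ⊠₁ φ s t).

Lemma cast_cons x s t (e : s = t) (e' : x :: s = x :: t) :
  cast w e' \; κ x t = κ x s \; (idm (f x) ⊠₁ cast w e).
Proof. by case: t / e e' => e'; rewrite !cast_id tmap_id !tmapE. Qed.

Lemma cast_cat s t s' t' (es : s = s') (et : t = t')
    (e : s ++ t = s' ++ t') :
  cast w e \; φ s' t' = φ s t \; (cast w es ⊠₁ cast w et).
Proof.
by case: s' / es e; case: t' / et => e; rewrite !cast_id tmap_id !tmapE.
Qed.

(** Induction on the first word. The empty word reduces to [assoc_lunit]; a leading letter is split
    off, and the pentagon moves it past the other three factors. *)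
Lemma catA_coherent s t u (e : (s ++ t) ++ u = s ++ t ++ u) :
  φ (s ++ t) u \; (φ s t ⊠₁ idm (w u)) \; α (w s) (w t) (w u) =
  cast w e \; φ s (t ++ u) \; (idm (w s) ⊠₁ φ t u).
Proof.
elim: s e => [|x s IHs] e.
  rewrite cast_id comp1m.
  apply: (@invertible_monic _ _ _ _ (λ (w t ⊠ w u))); auto.
  rewrite -!compA assoc_lunit lunit_natural // -tmap_compl cat_nil.
  by rewrite (reassoc _ (cat_nil _)) tmap_id comp1m compm1.
have e' : (s ++ t) ++ u = s ++ t ++ u by rewrite catA.
(* Appending [κ] and an associator isolates the letter [x] at the far left on both sides, where
   [cat_cons] and the induction hypothesis apply. *)
apply: (@invertible_monic _ _ _ _ ((κ x s ⊠₁ idm (w t ⊠ w u)) \; α _ _ _));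
  auto.
rewrite -!compA -tmap_id (reassoc _ (esym (assoc_natural monM _ _ _))) -!compA.
rewrite pentagon // !tmapE -compA cat_cons.
rewrite tmap_compl -!compA (reassoc _ (assoc_natural monM _ _ _)) -!compA.
rewrite (reassoc3 _ (cat_cons _ _ _)) -!compA !tmapE (IHs e').
rewrite tmap_compr (reassoc _ (esym (cast_cons e' _))) -!compA.
rewrite tmap_id compm1 [κ x s ⊠₁ _]tmap_lr -!compA -[idm (_ ⊠ _)]tmap_id.
rewrite assoc_natural //.
by rewrite (reassoc3 _ (cat_cons _ _ _)) -!compA !tmapE.
Qed.

(** For the empty word this is the agreement of the two unitors at the unit; for a letter in front
    it is [assoc_runit]. *)
Lemma cats0_coherent s (e : s ++ [::] = s) :
  φ s [::] \; ρ (w s) = cast w e.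
Proof.
elim: s e => [|x s IHs] e.
  by rewrite cast_id -lunit_runit_unit cat_nil.
have e' : s ++ [::] = s by rewrite cats0.
apply: (@invertible_monic _ _ _ _ (κ x s)); auto.
rewrite (cast_cons e') -(IHs e') tmap_compr (reassoc _ (esym (cat_cons _ _ _))).
by rewrite -!compA assoc_runit runit_natural.
Qed.

Lemma cat1s_coherent x t : κ x [::] \; ρ (f x) = idm (f x) ->
  φ [:: x] t = κ x t :> hom _ _.
Proof.
move=> cons_nil.
have := congr1 (comp^~ (idm (f x) ⊠₁ λ (w t))) (cat_cons x [::] t).
rewrite -!compA triangle // !tmapE cat_nil cons_nil tmap_id.
by rewrite !compm1.
Qed.

Lemma cast_cons2 x y s t (exy : x = y) (est : s = t) (e : x :: s = y :: t) :
  cast w e \; κ y t = κ x s \; (cast f exy ⊠₁ cast w est).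
Proof.
by case: y / exy e; case: t / est => e; rewrite !cast_id tmap_id !tmapE.
Qed.

End WordCoherence.

Lemma word_cat_nil T (f : T -> C) t :
  word_cat M f [::] t \; λ (word M f t) = idm (word M f t).
Proof. exact: bwdK. Qed.

Lemma word_cons_nil T (f : T -> C) x :
  word_cons M f x [::] \; ρ (f x) = idm (f x).
Proof. exact: bwdK. Qed.

(** The recursion for [word_cat] with its inverse isomorphisms moved to the other side, which is the
    shape assumed of [φ] above. *)
Lemma word_cat_cons T (f : T -> C) x s t :
  word_cat M f (x :: s) t \; (word_cons M f x s ⊠₁ idm (word M f t))
    \; α (f x) (word M f s) (word M f t) =
  word_cons M f x (s ++ t) \; (idm (f x) ⊠₁ word_cat M f s t).
Proof.
rewrite -[fwd (word_cat _ _ _ _)]/(_ \; _ \; _ \; _) -!compA.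
by rewrite tmap_compEA bwdK comp1m tmap_id comp1m bwdK compm1.
Qed.

End Monoidal.

(** * Coherence of the product of polynomials *)

(** Normalises a composite: nested to the right, adjacent tensors of arrows fused, identities
    dropped. *)
Ltac merge := repeat first [rewrite -compA | rewrite tmapE].

#[local] Hint Resolve rig_axioms sum_symmon prod_symmon : core.

Section RigCoherence.
Variable C : rig_category.
Local Notation rigC := (rig_axioms C).
Local Notation "𝟘" := (tunit (rig_add C)).
Local Notation "α⊕" := (assoc (rig_add C)).
Local Notation "λ⊕" := (lunit (rig_add C)).
Local Notation "ρ⊕" := (runit (rig_add C)).
Local Notation "α⊗" := (assoc (rig_mul C)).
Local Notation "λ⊗" := (lunit (rig_mul C)).
Local Notation "ρ⊗" := (runit (rig_mul C)).
Local Notation "'δl'" := (@distl C).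
Local Notation "'δr'" := (@distr C).
Local Notation "λ•" := (@lann C).
Local Notation "ρ•" := (@rann C).
Local Notation mono := (monomial C).
Local Notation poly := (polynomial C).
Local Notation m := (@interp_mono C).
Local Notation π := (@interp C).
Local Notation "U *: P" := (map (cat U) P) (at level 40).
Local Notation "P ** Q" := (poly_prod P Q) (at level 40).

(* The isomorphisms are variables subject to the equations of their recursions:
   rewriting with the recursive definitions would unfold them. *)
Variable κ : forall (U : mono) (P : poly), iso (π (U :: P)) (m U ⊕ π P).
Variable φ : forall P Q : poly, iso (π (P ++ Q)) (π P ⊕ π Q).
Variable μ : forall U V : mono, iso (m (U ++ V)) (m U ⊗ m V).
Variable sc : forall (U : mono) (P : poly), iso (π (U *: P)) (m U ⊗ π P).
Variable ψ : forall P Q : poly, iso (π (P ** Q)) (π P ⊗ π Q).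

Hypothesis κ_nil : forall U, κ U [::] \; ρ⊕ (m U) = idm (m U).
Hypothesis φ_nil : forall P, φ [::] P \; λ⊕ (π P) = idm (π P).
Hypothesis φ_cons : forall U P Q,
  φ (U :: P) Q \; (κ U P ⊕₁ idm (π Q)) \; α⊕ (m U) (π P) (π Q) =
  κ U (P ++ Q) \; (idm (m U) ⊕₁ φ P Q).
Hypothesis φs0 : forall P (e : P ++ [::] = P), φ P [::] \; ρ⊕ (π P) = cast π e.
Hypothesis φA : forall P Q R (e : (P ++ Q) ++ R = P ++ Q ++ R),
  φ (P ++ Q) R \; (φ P Q ⊕₁ idm (π R)) \; α⊕ (π P) (π Q) (π R) =
  cast π e \; φ P (Q ++ R) \; (idm (π P) ⊕₁ φ Q R).
Hypothesis φ_single : forall U P, φ [:: U] P = κ U P :> hom _ _.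
Hypothesis μ_nil : forall U, μ [::] U \; λ⊗ (m U) = idm (m U).
Hypothesis μs0 : forall U (e : U ++ [::] = U), μ U [::] \; ρ⊗ (m U) = cast m e.
Hypothesis μA : forall U V W (e : (U ++ V) ++ W = U ++ V ++ W),
  μ (U ++ V) W \; (μ U V ⊗₁ idm (m W)) \; α⊗ (m U) (m V) (m W) =
  cast m e \; μ U (V ++ W) \; (idm (m U) ⊗₁ μ V W).
Hypothesis sc_nil : forall U, sc U [::] \; ρ• (m U) = idm 𝟘.
Hypothesis sc_cons : forall U V P,
  sc U (V :: P) \; (idm (m U) ⊗₁ κ V P) \; δl (m U) (m V) (π P) =
  κ (U ++ V) (U *: P) \; (μ U V ⊕₁ sc U P).
Hypothesis ψ_nil : forall P, ψ [::] P \; λ• (π P) = idm 𝟘.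
Hypothesis ψ_cons : forall U P Q,
  ψ (U :: P) Q \; (κ U P ⊗₁ idm (π Q)) \; δr (m U) (π P) (π Q) =
  φ (U *: Q) (P ** Q) \; (sc U Q ⊕₁ ψ P Q).

Lemma sum_cast P Q P' Q' (eP : P = P') (eQ : Q = Q')
    (e : P ++ Q = P' ++ Q') :
  φ P Q \; (cast π eP ⊕₁ cast π eQ) = cast π e \; φ P' Q'.
Proof. by rewrite (cast_cat φ eP eQ). Qed.

(** Induction on [P]: [laplaza19] treats a zero summand, and [laplaza5], the compatibility of the
    left distributor with the additive associator, treats a leading monomial. *)
Lemma scale_cat U P Q (e : U *: (P ++ Q) = U *: P ++ U *: Q) :
  sc U (P ++ Q) \; (idm (m U) ⊗₁ φ P Q) \; δl (m U) (π P) (π Q) =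
  cast π e \; φ (U *: P) (U *: Q) \; (sc U P ⊕₁ sc U Q).
Proof.
elim: P e => [|V P IHP] e.
  rewrite cast_id comp1m.
  apply: (@invertible_monic _ _ _ _
    (ρ• (m U) ⊕₁ idm (m U ⊗ π Q) \; λ⊕ (m U ⊗ π Q))); auto.
  rewrite -!compA laplaza19 // !tmapE sc_nil φ_nil tmap_id compm1.
  by rewrite (lunit_natural (sum_symmon rigC)) (reassoc _ (φ_nil _)) comp1m.
have e' : U *: (P ++ Q) = U *: P ++ U *: Q by rewrite map_cat.
apply: (@invertible_monic _ _ _ _
  (idm (m U) ⊗₁ κ V P ⊕₁ idm (m U ⊗ π Q) \; δl _ _ _ ⊕₁ idm (m U ⊗ π Q)
   \; α⊕ (m U ⊗ m V) (m U ⊗ π P) (m U ⊗ π Q))); auto.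
rewrite -[in LHS]tmap_id -?compA (reassoc _ (esym (distl_natural rigC _ _ _))).
rewrite -?compA tmap_id laplaza5 //; merge; rewrite φ_cons.
rewrite tmap_compr -?compA (reassoc _ (distl_natural rigC _ _ _)) -?compA.
rewrite (reassoc3 _ (sc_cons _ _ _)); merge; rewrite tmap_id; merge.
rewrite (IHP e').
rewrite -?compA sc_cons tmap_left -?compA (assoc_natural (sum_symmon rigC)).
rewrite (reassoc3 _ (φ_cons _ _ _)) -?compA (reassoc _ (cast_cons κ e' _)).
by merge.
Qed.

(** The mirror image of [scale_cat], by [laplaza20] and [laplaza4]. A leading monomial [U] now
    contributes the whole block [U *: R], so associativity of [φ] is used where a cons sufficed
    before. *)
Lemma prod_cat P Q R (e : (P ++ Q) ** R = P ** R ++ Q ** R) :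
  ψ (P ++ Q) R \; (φ P Q ⊗₁ idm (π R)) \; δr (π P) (π Q) (π R) =
  cast π e \; φ (P ** R) (Q ** R) \; (ψ P R ⊕₁ ψ Q R).
Proof.
elim: P e => [|U P IHP] e.
  rewrite cast_id comp1m.
  apply: (@invertible_monic _ _ _ _
    (λ• (π R) ⊕₁ idm (π Q ⊗ π R) \; λ⊕ (π Q ⊗ π R))); auto.
  rewrite -?compA laplaza20 // !tmapE ψ_nil φ_nil tmap_id compm1.
  by rewrite (lunit_natural (sum_symmon rigC)) (reassoc _ (φ_nil _)) comp1m.
have e' : (P ++ Q) ** R = P ** R ++ Q ** R by rewrite poly_prodDl.
apply: (@invertible_monic _ _ _ _
  (κ U P ⊗₁ idm (π R) ⊕₁ idm (π Q ⊗ π R) \; δr _ _ _ ⊕₁ idm (π Q ⊗ π R)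
   \; α⊕ (m U ⊗ π R) (π P ⊗ π R) (π Q ⊗ π R))); auto.
rewrite -[in LHS]tmap_id -?compA (reassoc _ (esym (distr_natural rigC _ _ _))).
rewrite -?compA tmap_id laplaza4 //; merge; rewrite φ_cons.
rewrite tmap_compl -?compA (reassoc _ (distr_natural rigC _ _ _)) -?compA.
rewrite (reassoc3 _ (ψ_cons U (P ++ Q) R)); merge; rewrite tmap_id; merge.
rewrite (IHP e').
rewrite -?compA ψ_cons tmap_left -?compA (assoc_natural (sum_symmon rigC)).
have e1 : (U *: R ++ P ** R) ++ Q ** R = U *: R ++ P ** R ++ Q ** R.
  by rewrite -catA.
have e2 : U *: R ++ (P ++ Q) ** R = U *: R ++ (P ** R ++ Q ** R) by rewrite e'.
rewrite (reassoc3 _ (φA e1)).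
(* The identity on the first summand is read as a transport, so that [sum_cast] can merge it with
   the one on the second. *)
rewrite tmap_right -(cast_id π erefl).
rewrite (reassoc _ (sum_cast erefl e' e2)); merge.
rewrite [RHS](reassoc _ (cast_comp π e e1)); congr (_ \; _); exact: cast_irr.
Qed.

Lemma prod0_coherent P (e : P ** [::] = [::]) :
  ψ P [::] \; ρ• (π P) = cast π e.
Proof.
elim: P e => [|U P IHP] e; first by rewrite cast_id -(laplaza10 rigC) ψ_nil.
have e' : P ** [::] = [::] by rewrite poly_prod0.
rewrite -(rann_natural rigC (κ U P)) -laplaza12 //.
rewrite (reassoc3 _ (ψ_cons U P [::])); merge; rewrite sc_nil (IHP e').
rewrite (lunit_natural (sum_symmon rigC)) (reassoc _ (φ_nil _)) comp1m.
exact: (cast_irr π e' e).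
Qed.

(** The product by a one-term polynomial ends in an empty block; collapsing that zero summand with
    [laplaza22] leaves scaling up to a transport. *)
Lemma mono_prod_coherent U P (e : [:: U] ** P = U *: P) :
  ψ [:: U] P = cast π e \; sc U P :> hom _ _.
Proof.
have := congr1 (comp^~ (idm _ ⊕₁ λ• _ \; ρ⊕ _)) (ψ_cons U [::] P).
rewrite -!compA laplaza22 //; merge; rewrite κ_nil tmap_id; merge => ->.
rewrite ψ_nil (runit_natural (sum_symmon rigC)).
have e' : U *: P ++ [::] = U *: P by rewrite cats0.
by rewrite (reassoc _ (φs0 e')); congr (_ \; _); exact: cast_irr.
Qed.

Lemma scale1_coherent P (e : [::] *: P = P) :
  sc [::] P \; λ⊗ (π P) = cast π e.
Proof.
elim: P e => [|V P IHP] e; first by rewrite cast_id -(laplaza14 rigC) sc_nil.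
have e' : [::] *: P = P by elim: P {e IHP} => //= ? ? ->.
apply: (@invertible_monic _ _ _ _ (κ V P)); auto.
rewrite (cast_cons κ e') -compA -(lunit_natural (prod_symmon rigC)).
rewrite -laplaza23 // (reassoc3 _ (sc_cons [::] V P)); merge.
by rewrite μ_nil (IHP e').
Qed.

Lemma prod1_coherent P (e : [:: [::]] ** P = P) :
  ψ [:: [::]] P \; λ⊗ (π P) = cast π e.
Proof.
have e1 : [:: [::]] ** P = [::] *: P by rewrite /poly_prod /= cats0.
have e2 : [::] *: P = P by rewrite -e1 e.
rewrite (mono_prod_coherent e1) -compA (scale1_coherent e2) cast_comp.
exact: cast_irr.
Qed.

Lemma scale_mono U V : sc U [:: V] = μ U V :> hom _ _.
Proof.
have := congr1 (comp^~ (idm _ ⊕₁ ρ• _ \; ρ⊕ _)) (sc_cons U V [::]).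
rewrite -!compA laplaza21 //; merge; rewrite κ_nil tmap_id; merge => ->.
rewrite sc_nil (runit_natural (sum_symmon rigC)).
by rewrite (reassoc _ (κ_nil _)) comp1m.
Qed.

Lemma prodr1_coherent P (e : P ** [:: [::]] = P) :
  ψ P [:: [::]] \; ρ⊗ (π P) = cast π e.
Proof.
elim: P e => [|U P IHP] e; first by rewrite cast_id -(laplaza13 rigC) ψ_nil.
have e' : P ** [:: [::]] = P by rewrite poly_prod1.
have eU : U ++ [::] = U by rewrite cats0.
apply: (@invertible_monic _ _ _ _ (κ U P)); auto.
rewrite (cast_cons2 κ eU e') -compA -(runit_natural (prod_symmon rigC)).
rewrite -laplaza24 // (reassoc3 _ (ψ_cons U P [:: [::]])); merge.
by rewrite (IHP e') scale_mono (μs0 eU) φ_single.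
Qed.

(** Associativity of the product is built in layers: three monomials ([μA]), then a polynomial in
    the last place (here, by [laplaza6] and [laplaza18]), then in the last two ([scale_prod]), then
    in all three ([prodA_coherent]). *)
Lemma scale_scale U V P (e : (U ++ V) *: P = U *: (V *: P)) :
  sc (U ++ V) P \; (μ U V ⊗₁ idm (π P)) \; α⊗ (m U) (m V) (π P) =
  cast π e \; sc U (V *: P) \; (idm (m U) ⊗₁ sc V P).
Proof.
elim: P e => [|W P IHP] e.
  rewrite cast_id comp1m.
  apply: (@invertible_monic _ _ _ _ (idm (m U) ⊗₁ ρ• (m V) \; ρ• (m U))); auto.
  rewrite -!compA laplaza18 // (rann_natural rigC) sc_nil; merge.
  by rewrite sc_nil tmap_id comp1m; exact: esym (sc_nil U).
have e' : (U ++ V) *: P = U *: (V *: P).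
  by rewrite -map_comp; apply: eq_map => ?; rewrite /= catA.
have eW : (U ++ V) ++ W = U ++ V ++ W by rewrite catA.
(* Distributing fully over the head [W] turns both sides into a sum: the head is handled by [μA] and
   the tail by induction. *)
apply: (@invertible_monic _ _ _ _ (idm (m U) ⊗₁ (idm (m V) ⊗₁ κ W P)
  \; idm (m U) ⊗₁ δl (m V) (m W) (π P) \; δl _ _ _)); auto.
rewrite -!compA (reassoc _ (esym (assoc_natural (prod_symmon rigC) _ _ _))).
rewrite -!compA -laplaza6 // tmap_id; merge.
rewrite tmap_rl -!compA -[idm (_ ⊕ _)]tmap_id.
rewrite (reassoc _ (distl_natural rigC _ _ _)) -!compA.
rewrite (reassoc3 _ (sc_cons (U ++ V) W P)); merge.
rewrite (μA eW) (IHP e') sc_cons tmap_compr -!compA.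
rewrite (distl_natural rigC) (reassoc3 _ (sc_cons U (V ++ W) (V *: P))) -!compA.
by rewrite [RHS](reassoc _ (cast_cons2 κ eW e' e)); merge.
Qed.

(** Here both distributors meet: [P] is expanded on the right of [U] and on the left of [Q], and
    [laplaza8] exchanges the two expansions. *)
Lemma scale_prod U P Q (e : (U *: P) ** Q = U *: (P ** Q)) :
  ψ (U *: P) Q \; (sc U P ⊗₁ idm (π Q)) \; α⊗ (m U) (π P) (π Q) =
  cast π e \; sc U (P ** Q) \; (idm (m U) ⊗₁ ψ P Q).
Proof.
elim: P e => [|V P IHP] e.
  rewrite cast_id comp1m.
  apply: (@invertible_monic _ _ _ _ (idm (m U) ⊗₁ λ• (π Q) \; ρ• (m U))); auto.
  rewrite -!compA laplaza17 //; merge; rewrite sc_nil tmap_id comp1m ψ_nil.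
  by rewrite tmap_id comp1m; exact: esym (sc_nil U).
have e' : (U *: P) ** Q = U *: (P ** Q).
  elim: P {IHP e} => //= W P IHP.
  rewrite -[LHS]/((U ++ W) *: Q ++ (U *: P) ** Q) IHP map_cat -map_comp.
  by congr (_ ++ _); apply: eq_map => ?; rewrite /= catA.
have eV : (U ++ V) *: Q = U *: (V *: Q).
  by rewrite -map_comp; apply: eq_map => ?; rewrite /= catA.
have e1 : (U ++ V) *: Q ++ (U *: P) ** Q = U *: (V *: Q) ++ U *: (P ** Q).
  by rewrite eV e'.
have e2 : U *: (V *: Q ++ P ** Q) = U *: (V *: Q) ++ U *: (P ** Q).
  by rewrite map_cat.
apply: (@invertible_monic _ _ _ _ (idm (m U) ⊗₁ (κ V P ⊗₁ idm (π Q))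
  \; idm (m U) ⊗₁ δr (m V) (π P) (π Q) \; δl _ _ _)); auto.
rewrite -!compA (reassoc _ (esym (assoc_natural (prod_symmon rigC) _ _ _))).
rewrite -!compA -laplaza8 //; merge; rewrite sc_cons tmap_compl -!compA.
rewrite (reassoc _ (distr_natural rigC _ _ _)) -!compA.
rewrite (reassoc3 _ (ψ_cons (U ++ V) (U *: P) Q)); merge.
rewrite (scale_scale eV) (IHP e') -tmap_compE.
rewrite (reassoc _ (sum_cast eV e' e1)) -!compA.
rewrite ψ_cons tmap_compr -!compA (distl_natural rigC).
rewrite (reassoc3 _ (scale_cat e2)) -!compA; merge.
rewrite [RHS](reassoc _ (cast_comp π e e2)); congr (_ \; _).
exact: (cast_irr π e1).
Qed.

Lemma prodA_coherent P Q R (e : (P ** Q) ** R = P ** (Q ** R)) :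
  ψ (P ** Q) R \; (ψ P Q ⊗₁ idm (π R)) \; α⊗ (π P) (π Q) (π R) =
  cast π e \; ψ P (Q ** R) \; (idm (π P) ⊗₁ ψ Q R).
Proof.
elim: P e => [|U P IHP] e.
  rewrite cast_id comp1m.
  apply: (@invertible_monic _ _ _ _ (λ• (π Q ⊗ π R))); auto.
  rewrite -!compA laplaza16 // (lann_natural rigC); merge; rewrite ψ_nil.
  rewrite tmap_id comp1m; exact: etrans (ψ_nil R) (esym (ψ_nil (Q ** R))).
have e' : (P ** Q) ** R = P ** (Q ** R) by rewrite poly_prodA.
have eU : (U *: Q) ** R = U *: (Q ** R).
  elim: Q {e e' IHP} => //= V Q IHQ.
  rewrite -[LHS]/((U ++ V) *: R ++ (U *: Q) ** R) IHQ map_cat -map_comp.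
  by congr (_ ++ _); apply: eq_map => ?; rewrite /= catA.
have e1 : (U *: Q) ** R ++ (P ** Q) ** R = U *: (Q ** R) ++ P ** (Q ** R).
  by rewrite eU e'.
have e2 : (U *: Q ++ P ** Q) ** R = (U *: Q) ** R ++ (P ** Q) ** R.
  by rewrite poly_prodDl.
apply: (@invertible_monic _ _ _ _ (κ U P ⊗₁ idm (π Q ⊗ π R)
  \; δr (m U) (π P) (π Q ⊗ π R))); auto.
rewrite -!compA -tmap_id.
rewrite (reassoc _ (esym (assoc_natural (prod_symmon rigC) _ _ _))).
rewrite -!compA -laplaza7 //; merge; rewrite ψ_cons tmap_compl -!compA.
rewrite (reassoc _ (distr_natural rigC _ _ _)) -!compA.
rewrite (reassoc3 _ (prod_cat e2)); merge.
rewrite (scale_prod eU) (IHP e') -tmap_compE.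
rewrite (reassoc _ (sum_cast eU e' e1)) -!compA.
rewrite tmap_id; merge; rewrite [κ _ _ ⊗₁ _]tmap_lr -!compA.
rewrite -[idm (_ ⊕ _)]tmap_id (distr_natural rigC).
rewrite (reassoc3 _ (ψ_cons U P (Q ** R))); merge.
rewrite [LHS](reassoc _ (cast_comp π e2 e1)); congr (_ \; _).
exact: (cast_irr π _ e).
Qed.

(** By [mono_prod_coherent] this is [scale_cat] up to transports. With two monomials on the left the
    two sides would list their summands in different orders, and the equation [e] of polynomials
    would fail in general. *)
Lemma mono_distl_coherent U P Q
    (e : [:: U] ** (P ++ Q) = [:: U] ** P ++ [:: U] ** Q) :
  ψ [:: U] (P ++ Q) \; (idm (m U) ⊗₁ φ P Q) \; δl (m U) (π P) (π Q) =
  cast π e \; φ ([:: U] ** P) ([:: U] ** Q) \; (ψ [:: U] P ⊕₁ ψ [:: U] Q).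
Proof.
have eU R : [:: U] ** R = U *: R by rewrite /poly_prod /= cats0.
have e1 : U *: (P ++ Q) = U *: P ++ U *: Q by rewrite map_cat.
have e2 : [:: U] ** P ++ [:: U] ** Q = U *: P ++ U *: Q by rewrite !eU.
rewrite !(mono_prod_coherent (eU _)) -tmap_compE.
rewrite (reassoc _ (sum_cast (eU P) (eU Q) e2)) -!compA (scale_cat e1).
rewrite !(compA (cast _ _) (cast _ _)) !cast_comp; congr (_ \; _).
exact: cast_irr.
Qed.

End RigCoherence.

(** * Coherence of the chosen structural isomorphisms *)

Section InterpCoherence.
Variable C : rig_category.
Local Notation rigC := (rig_axioms C).
Local Notation mono := (monomial C).
Local Notation poly := (polynomial C).
Local Notation m := (@interp_mono C).
Local Notation π := (@interp C).
Local Notation "U *: P" := (map (cat U) P) (at level 40).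
Local Notation "P ** Q" := (poly_prod P Q) (at level 40).
Local Notation κ := (word_cons (rig_add C) m).
Local Notation φ := (@interp_cat C).
Local Notation μ := (word_cat (rig_mul C) id).
Local Notation sc := (@interp_scale C).
Local Notation ψ := (@interp_prod C).

Lemma interp_scale_nil (U : mono) :
  sc U [::] \; rann (m U) = idm (tunit (rig_add C)).
Proof. exact: bwdK. Qed.

Lemma interp_scale_cons (U V : mono) (P : poly) :
  sc U (V :: P) \; (idm (m U) ⊗₁ κ V P) \; distl (m U) (m V) (π P) =
  κ (U ++ V) (U *: P) \; (μ U V ⊕₁ sc U P).
Proof.
(* Exactly one layer of the recursion is exposed; its trailing inverses cancel against the arrows in
   the statement. *)
rewrite -[fwd (sc _ _)]/(_ \; _ \; _ \; _); merge.
by rewrite bwdK tmap_id; merge; rewrite bwdK; merge.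
Qed.

Lemma interp_prod_nil (P : poly) :
  ψ [::] P \; lann (π P) = idm (tunit (rig_add C)).
Proof. exact: bwdK. Qed.

Lemma interp_prod_cons (U : mono) (P Q : poly) :
  ψ (U :: P) Q \; (κ U P ⊗₁ idm (π Q)) \; distr (m U) (π P) (π Q) =
  φ (U *: Q) (P ** Q) \; (sc U Q ⊕₁ ψ P Q).
Proof.
rewrite -[fwd (ψ _ _)]/(_ \; _ \; _ \; _); merge.
by rewrite bwdK tmap_id; merge; rewrite bwdK; merge.
Qed.

Lemma interp_cons_nil U : κ U [::] \; runit _ (m U) = idm (m U).
Proof. exact: word_cons_nil. Qed.

Lemma interp_cat_nil P : φ [::] P \; lunit _ (π P) = idm (π P).
Proof. exact: word_cat_nil. Qed.

Lemma interp_cat_cons U P Q :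
  φ (U :: P) Q \; (κ U P ⊕₁ idm (π Q)) \; assoc _ (m U) (π P) (π Q) =
  κ U (P ++ Q) \; (idm (m U) ⊕₁ φ P Q).
Proof. exact: word_cat_cons. Qed.

Lemma interp_mono_cat_nil (U : mono) : μ [::] U \; lunit _ (m U) = idm (m U).
Proof. exact: word_cat_nil. Qed.

Lemma interp_catA P Q R (e : (P ++ Q) ++ R = P ++ Q ++ R) :
  φ (P ++ Q) R \; (φ P Q ⊕₁ idm (π R)) \; assoc _ (π P) (π Q) (π R) =
  cast π e \; φ P (Q ++ R) \; (idm (π P) ⊕₁ φ Q R).
Proof.
exact: (catA_coherent (sum_symmon rigC) interp_cat_nil interp_cat_cons).
Qed.

Lemma interp_cats0 P (e : P ++ [::] = P) :
  φ P [::] \; runit (rig_add C) (π P) = cast π e.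
Proof.
exact: (cats0_coherent (sum_symmon rigC) interp_cat_nil interp_cat_cons).
Qed.

Lemma interp_cat_single U P : φ [:: U] P = κ U P :> hom _ _.
Proof.
exact: (cat1s_coherent (sum_symmon rigC) interp_cat_nil interp_cat_cons P
  (interp_cons_nil U)).
Qed.

Lemma interp_mono_catA (U V W : mono) (e : (U ++ V) ++ W = U ++ V ++ W) :
  μ (U ++ V) W \; (μ U V ⊗₁ idm (m W)) \; assoc _ (m U) (m V) (m W) =
  cast m e \; μ U (V ++ W) \; (idm (m U) ⊗₁ μ V W).
Proof.
exact: (catA_coherent (prod_symmon rigC) interp_mono_cat_nil
  (@word_cat_cons _ (rig_mul C) _ id)).
Qed.

Lemma interp_mono_cats0 (U : mono) (e : U ++ [::] = U) :
  μ U [::] \; runit (rig_mul C) (m U) = cast m e.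
Proof.
exact: (cats0_coherent (prod_symmon rigC) interp_mono_cat_nil
  (@word_cat_cons _ (rig_mul C) _ id)).
Qed.

Lemma interp_prodA P Q R (e : (P ** Q) ** R = P ** (Q ** R)) :
  ψ (P ** Q) R \; (ψ P Q ⊗₁ idm (π R)) \; assoc _ (π P) (π Q) (π R) =
  cast π e \; ψ P (Q ** R) \; (idm (π P) ⊗₁ ψ Q R).
Proof.
exact: (prodA_coherent interp_cat_nil interp_cat_cons interp_catA
  interp_mono_catA interp_scale_nil interp_scale_cons interp_prod_nil
  interp_prod_cons).
Qed.

Lemma interp_1prod P (e : [:: [::]] ** P = P) :
  ψ [:: [::]] P \; lunit _ (π P) = cast π e.
Proof.
exact: (prod1_coherent interp_cons_nil interp_cats0 interp_mono_cat_nil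
  interp_scale_nil interp_scale_cons interp_prod_nil interp_prod_cons).
Qed.

Lemma interp_prod1 P (e : P ** [:: [::]] = P) :
  ψ P [:: [::]] \; runit _ (π P) = cast π e.
Proof.
exact: (prodr1_coherent interp_cons_nil interp_cat_single interp_mono_cats0
  interp_scale_nil interp_scale_cons interp_prod_nil interp_prod_cons).
Qed.

Lemma interp_prod0 P (e : P ** [::] = [::]) : ψ P [::] \; rann (π P) = cast π e.
Proof.
exact: (prod0_coherent interp_cat_nil interp_scale_nil interp_prod_nil
  interp_prod_cons).
Qed.

Lemma interp_distr P Q R (e : (P ++ Q) ** R = P ** R ++ Q ** R) :
  ψ (P ++ Q) R \; (φ P Q ⊗₁ idm (π R)) \; distr (π P) (π Q) (π R) =
  cast π e \; φ (P ** R) (Q ** R) \; (ψ P R ⊕₁ ψ Q R).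
Proof.
exact: (prod_cat interp_cat_nil interp_cat_cons interp_catA interp_prod_nil
  interp_prod_cons).
Qed.

Lemma interp_mono_distl U P Q
    (e : [:: U] ** (P ++ Q) = [:: U] ** P ++ [:: U] ** Q) :
  ψ [:: U] (P ++ Q) \; (idm (m U) ⊗₁ φ P Q) \; distl (m U) (π P) (π Q) =
  cast π e \; φ ([:: U] ** P) ([:: U] ** Q) \; (ψ [:: U] P ⊕₁ ψ [:: U] Q).
Proof.
exact: (mono_distl_coherent interp_cons_nil interp_cat_nil interp_cat_cons
  interp_cats0 interp_scale_nil interp_scale_cons interp_prod_nil
  interp_prod_cons).
Qed.

End InterpCoherence.

(** * Transfer of the axioms to the strictification *)

Lemma iso_eq_identity (C : category) (X Y : C) (e : X = Y) :
  is_identity (iso_eq e).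
Proof. by case: Y / e. Qed.

Section Transfer.
Variable C : rig_category.
Local Notation rigC := (rig_axioms C).
Local Notation SC := (strictification C).
Local Notation π := (@interp C).

(** The identity function, marking that an arrow of s(C) is now read, and composed, in [C]. *)
Definition underlying (P Q : SC) (f : hom P Q) : hom (π P) (π Q) := f.
Local Notation "⌊ f ⌋" := (underlying f) (at level 0, format "⌊ f ⌋").

Lemma underlying_eq (P Q : SC) (e : P = Q) : ⌊iso_eq e⌋ = cast π e.
Proof. by case: Q / e. Qed.

(** The structure of a strong symmetric monoidal functor on π. As π is the identity on arrows, only
    the comparison isomorphisms are data. *)
Record strong_monoidal (N : symmon_data SC) (M : symmon_data C) :=
  StrongMonoidal {
  tcmp : forall P Q : SC, iso (π (tob N P Q)) (tob M (π P) (π Q));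
  ucmp : iso (π (tunit N)) (tunit M);
  tcmp_natural : forall (P Q P' Q' : SC) (f : hom P P') (g : hom Q Q'),
    ⌊tmap N f g⌋ \; tcmp P' Q' = tcmp P Q \; tmap M ⌊f⌋ ⌊g⌋;
  tcmp_assoc : forall P Q R : SC,
    ⌊assoc N P Q R⌋ \; tcmp P (tob N Q R) \; tmap M (idm (π P)) (tcmp Q R) =
    tcmp (tob N P Q) R \; tmap M (tcmp P Q) (idm (π R)) \; assoc M _ _ _;
  tcmp_lunit : forall P : SC,
    ⌊lunit N P⌋ = tcmp (tunit N) P \; tmap M ucmp (idm (π P)) \; lunit M _;
  tcmp_runit : forall P : SC,
    ⌊runit N P⌋ = tcmp P (tunit N) \; tmap M (idm (π P)) ucmp \; runit M _;
  tcmp_braid : forall P Q : SC,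
    ⌊braid N P Q⌋ \; tcmp Q P = tcmp P Q \; braid M _ _ }.

Lemma conj_tmapE (M : symmon_data C) (t : SC -> SC -> SC)
    (c : forall P Q, iso (π (t P Q)) (tob M (π P) (π Q))) P Q P' Q'
    (f : hom (π P) (π P')) (g : hom (π Q) (π Q')) :
  conj_tmap c f g \; c P' Q' = c P Q \; tmap M f g.
Proof. by rewrite /conj_tmap -!compA bwdK compm1. Qed.

Lemma conj_braidE (M : symmon_data C) (t : SC -> SC -> SC)
    (c : forall P Q, iso (π (t P Q)) (tob M (π P) (π Q))) P Q :
  conj_braid c P Q \; c Q P = c P Q \; braid M (π P) (π Q).
Proof.
by rewrite -[fwd (conj_braid _ _ _)]/(_ \; _ \; _) -!compA bwdK compm1.
Qed.

(** Built transparently, because later proofs rely on [tcmp] computing to [interp_cat]; likewise for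
    [interp_mul]. *)
Definition interp_sum : strong_monoidal (rig_add SC) (rig_add C).
Proof.
exists (@interp_cat C) (iso_id _).
- by move=> *; exact: conj_tmapE.
- by move=> P Q R; rewrite underlying_eq; exact: esym (interp_catA _).
- move=> P; rewrite underlying_eq tmap_id comp1m cast_id.
  exact: esym (interp_cat_nil P).
- move=> P; rewrite underlying_eq tmap_id comp1m.
  exact: esym (interp_cats0 _).
- by move=> *; exact: conj_braidE.
Defined.

Definition interp_mul : strong_monoidal (rig_mul SC) (rig_mul C).
Proof.
exists (@interp_prod C) (iso_id _).
- by move=> *; exact: conj_tmapE.
- by move=> P Q R; rewrite underlying_eq; exact: esym (interp_prodA _).
- move=> P; rewrite underlying_eq tmap_id comp1m.
  exact: esym (interp_1prod _).
- move=> P; rewrite underlying_eq tmap_id comp1m.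
  exact: esym (interp_prod1 _).
- by move=> *; exact: conj_braidE.
Defined.

(** * Framed objects and lifted arrows *)

(** Since π preserves tensors only up to isomorphism, an object of s(C) is paired with the bracketed
    expression of [C] that it stands for; the structure maps of [C] apply to [val]. *)
Record framed := Framed { poly : SC; val : C; frame : iso (π poly) val }.

Definition framed_of (P : SC) := Framed (iso_id (π P)).

Section FramedTensor.
Variables (N : symmon_data SC) (M : symmon_data C) (F : strong_monoidal N M).

Definition framed_tensor (A B : framed) :=
  Framed (tcmp F (poly A) (poly B) \;; tmap_iso M (frame A) (frame B)).

Definition framed_unit := Framed (ucmp F).

End FramedTensor.

Definition lifts (A B : framed) (f : hom (poly A) (poly B))
    (g : hom (val A) (val B)) : Prop :=
  ⌊f⌋ \; frame B = frame A \; g.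

(** The transfer principle: frames are invertible and π is faithful, so an equation of [C] between
    the images gives the equation in s(C). *)
Lemma lifts_inj A B f f' g g' :
  @lifts A B f g -> @lifts A B f' g' -> g = g' -> f = f'.
Proof.
move=> fg fg' eq_g; apply: (@invertible_monic C _ _ _ (frame B)) => //.
by rewrite [LHS]fg [RHS]fg' eq_g.
Qed.

Lemma lifts_of (P Q : SC) (f : hom P Q) :
  @lifts (framed_of P) (framed_of Q) f ⌊f⌋.
Proof. by rewrite /lifts comp1m compm1. Qed.

Lemma lifts_id A : @lifts A A (idm _) (idm _).
Proof. by rewrite /lifts compm1 [LHS]comp1m. Qed.

Lemma lifts_comp A B D f g f' g' :
  @lifts A B f g -> @lifts B D f' g' -> @lifts A D (f \; f') (g \; g').
Proof.
rewrite /lifts => fg fg'; rewrite compA -fg -compA -fg'.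
by rewrite compA.
Qed.

Lemma lifts_inv A B (i : iso (poly A) (poly B)) (j : iso (val A) (val B)) :
  @lifts A B i j -> @lifts B A (iso_inv i) (iso_inv j).
Proof.
rewrite /lifts => ij; apply: (@invertible_epic C _ _ _ ⌊i⌋).
  by exists ⌊bwd i⌋; split; [exact: fwdK i | exact: bwdK i].
rewrite (reassoc _ ij) -!compA fwdK compm1.
by rewrite compA [⌊i⌋ \; _](fwdK i) comp1m.
Qed.

Section LiftsTensor.
Variables (N : symmon_data SC) (M : symmon_data C) (F : strong_monoidal N M).
Hypothesis monM : is_symmon M.
Local Notation "A ⊠ B" := (framed_tensor F A B)
  (at level 40, left associativity).
Local Notation I := (framed_unit F).

Lemma lifts_tmap A B A' B' f g f' g' :
  @lifts A A' f g -> @lifts B B' f' g' ->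
  @lifts (A ⊠ B) (A' ⊠ B') (tmap N f f') (tmap M g g').
Proof.
rewrite /lifts /= => fg fg'.
by rewrite compA tcmp_natural -!compA !tmapE fg fg'.
Qed.

Lemma lifts_assoc A B D :
  @lifts (A ⊠ B ⊠ D) (A ⊠ (B ⊠ D)) (assoc N _ _ _) (assoc M _ _ _).
Proof.
rewrite /lifts /=; merge; rewrite !tmap_right tmap_left -!compA.
by rewrite (reassoc3 _ (tcmp_assoc F _ _ _)) assoc_natural // -!compA.
Qed.

Lemma lifts_lunit A : @lifts (I ⊠ A) A (lunit N _) (lunit M _).
Proof.
rewrite /lifts (tcmp_lunit F) /= -!compA -(lunit_natural monM).
by merge.
Qed.

Lemma lifts_runit A : @lifts (A ⊠ I) A (runit N _) (runit M _).
Proof.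
rewrite /lifts (tcmp_runit F) /= -!compA -(runit_natural monM).
by merge.
Qed.

Lemma lifts_braid A B : @lifts (A ⊠ B) (B ⊠ A) (braid N _ _) (braid M _ _).
Proof.
by rewrite /lifts /= compA tcmp_braid -!compA braid_natural.
Qed.

End LiftsTensor.

Local Notation "A ⊞ B" := (framed_tensor interp_sum A B)
  (at level 50, left associativity).
Local Notation "A ⊠ B" := (framed_tensor interp_mul A B)
  (at level 40, left associativity).
Local Notation "0" := (framed_unit interp_sum).

Lemma lifts_distr A B D :
  @lifts ((A ⊞ B) ⊠ D) (A ⊠ D ⊞ B ⊠ D) (distr _ _ _) (distr _ _ _).
Proof.
rewrite /lifts underlying_eq /=; merge; rewrite [in RHS]tmap_left -!compA.
rewrite (distr_natural rigC) (reassoc3 _ (interp_distr _)).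
  exact: poly_prodDl.
move=> e; rewrite -!compA; merge.
by congr (_ \; _); exact: cast_irr.
Qed.

Lemma lifts_distl A B D :
  @lifts (A ⊠ (B ⊞ D)) (A ⊠ B ⊞ A ⊠ D) (distl _ _ _) (distl _ _ _).
Proof.
(* In s(C) the left distributor is defined from the right one and braidings. [laplaza2] and the
   involutivity of the braiding write that of [C] in the same way, so it lifts factor by factor. *)
have -> : distl (val A) (val B) (val D) =
    braid (rig_mul C) (val A) (val B ⊕ val D) \;
    distr (val B) (val D) (val A) \;
    (braid (rig_mul C) (val B) (val A) ⊕₁ braid (rig_mul C) (val D) (val A))
    :> hom _ _.
  by rewrite laplaza2 // compA (braidK (prod_symmon rigC)) comp1m.
have braidP X Y := lifts_braid interp_mul (prod_symmon rigC) X Y.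
exact: (lifts_comp (braidP A (B ⊞ D)) (lifts_comp (lifts_distr B D A)
  (lifts_tmap interp_sum (braidP B A) (braidP D A)))).
Qed.

Lemma lifts_lann A : @lifts (0 ⊠ A) 0 (lann _) (lann _).
Proof.
rewrite /lifts underlying_eq cast_id /= -!compA; merge.
by rewrite (lann_natural rigC) bwdK.
Qed.

Lemma lifts_rann A : @lifts (A ⊠ 0) 0 (rann _) (rann _).
Proof.
rewrite /lifts underlying_eq /= -!compA; merge.
by rewrite (rann_natural rigC); exact: esym (interp_prod0 _).
Qed.

(** Rebuilds an object expression of s(C) as a framed object with the same tree, trivially framed at
    the leaves, so that [val] is the same expression in [C]. *)
Ltac reframe P :=
  lazymatch P with
  | tob (rig_add _) ?X ?Y =>
      let A := reframe X in let B := reframe Y in constr:(A ⊞ B)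
  | tob (rig_mul _) ?X ?Y =>
      let A := reframe X in let B := reframe Y in constr:(A ⊠ B)
  | tunit (rig_add _) => constr:(framed_unit interp_sum)
  | tunit (rig_mul _) => constr:(framed_unit interp_mul)
  | _ => constr:(framed_of P)
  end.

Ltac lift :=
  lazymatch goal with
  | |- lifts (@comp _ _ ?P _ _ _) _ =>
      let A := reframe P in apply: (@lifts_comp _ A); lift
  | |- lifts (tmap (rig_add _) _ _) _ => apply: (lifts_tmap interp_sum); lift
  | |- lifts (tmap (rig_mul _) _ _) _ => apply: (lifts_tmap interp_mul); lift
  | |- lifts (idm _) _ => exact: lifts_id
  | |- lifts (fwd (@iso_inv _ ?P ?Q _)) _ =>
      let A := reframe P in let B := reframe Q in apply: (@lifts_inv A B); lift
  | |- lifts (fwd (assoc (rig_add _) _ _ _)) _ =>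
      exact: (lifts_assoc interp_sum (sum_symmon rigC))
  | |- lifts (fwd (assoc (rig_mul _) _ _ _)) _ =>
      exact: (lifts_assoc interp_mul (prod_symmon rigC))
  | |- lifts (fwd (lunit (rig_add _) _)) _ =>
      exact: (lifts_lunit interp_sum (sum_symmon rigC))
  | |- lifts (fwd (lunit (rig_mul _) _)) _ =>
      exact: (lifts_lunit interp_mul (prod_symmon rigC))
  | |- lifts (fwd (runit (rig_add _) _)) _ =>
      exact: (lifts_runit interp_sum (sum_symmon rigC))
  | |- lifts (fwd (runit (rig_mul _) _)) _ =>
      exact: (lifts_runit interp_mul (prod_symmon rigC))
  | |- lifts (fwd (braid (rig_add _) _ _)) _ =>
      exact: (lifts_braid interp_sum (sum_symmon rigC))
  | |- lifts (fwd (braid (rig_mul _) _ _)) _ =>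
      exact: (lifts_braid interp_mul (prod_symmon rigC))
  | |- lifts (fwd (distl _ _ _)) _ => exact: lifts_distl
  | |- lifts (fwd (distr _ _ _)) _ => exact: lifts_distr
  | |- lifts (fwd (lann _)) _ => exact: lifts_lann
  | |- lifts (fwd (rann _)) _ => exact: lifts_rann
  | |- lifts _ _ => exact: lifts_of
  end.

(** Frames source and target, lifts both sides constructor by constructor, and closes the remaining
    equation with the axiom [H] of [C]. *)
Ltac transfer H :=
  lazymatch goal with
  | |- @eq (@hom _ ?P ?Q) _ _ =>
      let A := reframe P in let B := reframe Q in
      apply: (@lifts_inj A B); [lift | lift | exact: H]
  end.

(** * Rig axioms, strictness and the left distributor of the strictification *)

Lemma sum_is_symmon : is_symmon (rig_add SC).
Proof.
have H := sum_symmon rigC.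
split=> *.
- transfer (assoc_natural H).
- transfer (lunit_natural H).
- transfer (runit_natural H).
- transfer (braid_natural H).
- transfer (pentagon H).
- transfer (triangle H).
- transfer (hexagon H).
- transfer (braidK H).
Qed.

Lemma prod_is_symmon : is_symmon (rig_mul SC).
Proof.
have H := prod_symmon rigC.
split=> *.
- transfer (assoc_natural H).
- transfer (lunit_natural H).
- transfer (runit_natural H).
- transfer (braid_natural H).
- transfer (pentagon H).
- transfer (triangle H).
- transfer (hexagon H).
- transfer (braidK H).
Qed.

Lemma strictification_is_rig : is_rig SC.
Proof.
have H := rigC.
split=> *; first exact: sum_is_symmon; first exact: prod_is_symmon.
- transfer (distl_natural H).
- transfer (distr_natural H).
- transfer (lann_natural H).
- transfer (rann_natural H).
- transfer (laplaza1 H).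
- transfer (laplaza2 H).
- transfer (laplaza3 H).
- transfer (laplaza4 H).
- transfer (laplaza5 H).
- transfer (laplaza6 H).
- transfer (laplaza7 H).
- transfer (laplaza8 H).
(* Unfolded so that [lift] sees the associators and the symmetry of which the interchange is
   composed. *)
- by rewrite /interchange; transfer (laplaza9 H).
- transfer (laplaza10 H).
- transfer (laplaza11 H).
- transfer (laplaza12 H).
- transfer (laplaza13 H).
- transfer (laplaza14 H).
- transfer (laplaza15 H).
- transfer (laplaza16 H).
- transfer (laplaza17 H).
- transfer (laplaza18 H).
- transfer (laplaza19 H).
- transfer (laplaza20 H).
- transfer (laplaza21 H).
- transfer (laplaza22 H).
- transfer (laplaza23 H).
- transfer (laplaza24 H).
Qed.

Lemma strictification_is_strict : is_strict_rig SC.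
Proof.
split=> [|||P Q R|P|P]; first exact: strictification_is_rig.
- by split=> *; exact: iso_eq_identity.
- by split=> *; exact: iso_eq_identity.
- exact: iso_eq_identity.
- exact: iso_eq_identity.
- exact: iso_eq_identity.
Qed.

Lemma distl_mono U (P Q : SC) : is_identity (distl ([:: U] : SC) P Q).
Proof.
have e : poly_prod [:: U] (P ++ Q) = poly_prod [:: U] P ++ poly_prod [:: U] Q.
  by rewrite /poly_prod /= !cats0 map_cat.
have -> : distl ([:: U] : SC) P Q = iso_eq (C := SC) e :> hom _ _.
  (* The two arrows are compared after the canonical isomorphism of their common target with the
     expanded sum of products in [C]. *)
  apply: (@invertible_monic C _ _ _ (interp_cat (poly_prod [:: U] P) _
    \; (interp_prod [:: U] P ⊕₁ interp_prod [:: U] Q))); auto.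
  (* Frames of leaves are identities, so the frames of the compound objects reduce to the comparison
     isomorphisms in [interp_mono_distl]. *)
  have frame_of R : fwd (frame (framed_of R)) = idm (π R) by [].
  have := lifts_distl (framed_of [:: U]) (framed_of P) (framed_of Q).
  rewrite /lifts.
  rewrite -[fwd (frame _) in LHS]/(_ \; (_ \; (_ ⊗₁ _)) ⊕₁ (_ \; (_ ⊗₁ _))).
  rewrite -[fwd (frame _) in RHS]/(_ \; (_ ⊗₁ (_ \; (_ ⊕₁ _)))).
  rewrite !frame_of !tmap_id !compm1 => distlE.
  have := interp_mono_distl e; rewrite [LHS]compA -(underlying_eq e) => interpE.
  exact: etrans distlE interpE.
exact: iso_eq_identity.
Qed.

End Transfer.

Theorem theorem4p5 (C : rig_category) :
  is_sesquistrict (discrete C) (strictification C) (letter C).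
Proof.
split=> [X Y f||A P Q].
- by case: Y / f; exact: IsIdentity.
- exact: strictification_is_strict.
- exact: distl_mono.
Qed.
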